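(* There is an absolute constant $c_2>0$ and, for every $p\in(0,1)$, a constant $c_1(p)>0$ such that for all sufficiently large $N$ (depending on $p$), $$ d_n^T(\{e(kx)\}_{k=-N}^N,L_p)\le\log^{-c_1(p)}N\quad\text{if } n\ge N\exp(-\log^{c_2}N), $$ and $$ d_n^T(\{e(kx/N)\}_{k\in\mathbb{Z}_N},L_p^N)\le\log^{-c_1(p)}N\quad\text{if } n\ge N\exp(-\log^{c_2}N). $$
   Context: $e(\theta)=\exp(2\pi i\theta)$ and $\log^aN=(\log N)^a$. In the first bound $L_p=L_p(\mathbb{T})$, $\mathbb{T}=\mathbb{R}/\mathbb{Z}$, with $\|f\|_p=(\int_{\mathbb T}|f|^p\,dx)^{1/p}$; in the second, $L_p^N$ is the space of functions on $\mathbb{Z}_N=\mathbb{Z}/N\mathbb{Z}$ with $\|f\|_{L_p^N}=(N^{-1}\sum_{x\in\mathbb{Z}_N}|f(x)|^p)^{1/p}$. The trigonometric width $d_n^T(K,X)$ is $\inf_{\Lambda}\sup_{f\in K}\inf_{g}\|f-g\|_X$, where the outer infimum is over sets $\Lambda$ of $n$ frequencies ($\Lambda\subset\mathbb{Z}$ in the first case, $\Lambda\subset\mathbb{Z}_N$ in the second; repetitions of frequencies are allowed, i.e. $|\Lambda|\le n$), and the inner infimum is over $g$ in the linear span of $\{e(kx)\}_{k\in\Lambda}$ (respectively $\{e(kx/N)\}_{k\in\Lambda}$). *)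

(* Defs.v *)
From HB Require Import structures.
From mathcomp Require Import all_boot all_order all_algebra finmap.
From mathcomp Require Import all_classical all_reals all_analysis.
From mathcomp Require Import complex.

Set Implicit Arguments.
Unset Strict Implicit.
Unset Printing Implicit Defensive.

Import Order.TTheory GRing.Theory Num.Theory.
Import numFieldNormedType.Exports.

Local Open Scope classical_set_scope.
Local Open Scope ring_scope.

(* e(t) = exp(2 pi i t) *)
Definition e {R : realType} (t : R) : R[i] :=
  Complex (cos (2 * pi * t)) (sin (2 * pi * t)).

(* Functions on R/Z are represented by functions on R, integrated over the
   fundamental domain [0, 1[. *)
Definition Lp_torus {R : realType} (p : R) (f : R -> R[i]) : \bar R :=
  ((\int[lebesgue_measure]_(x in `[0%R, 1%R[)
      ((complex.Re `|f x|) `^ p)%:E) `^ p^-1)%E.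

(* The type 'Z_N has N elements only for N >= 2. *)
Definition Lp_cyclic {R : realType} (N : nat) (p : R) (f : 'Z_N -> R[i]) :
    \bar R :=
  ((N%:R^-1 * \sum_(x : 'Z_N) (complex.Re `|f x|) `^ p) `^ p^-1)%:E.

Definition char_torus {R : realType} (k : int) : R -> R[i] :=
  fun x => e (k%:~R * x).

(* The value does not depend on the representatives of k and x modulo N. *)
Definition char_cyclic {R : realType} (N : nat) (k : 'Z_N) : 'Z_N -> R[i] :=
  fun x => e (((k : nat)%:R * (x : nat)%:R / N%:R) : R).

Definition char_span {R : realType} {I : choiceType} {X : Type}
    (chi : I -> X -> R[i]) (Lambda : {fset I}) : set (X -> R[i]) :=
  [set g | exists a : I -> R[i],
     g = fun x => \sum_(k <- Lambda) a k * chi k x].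

(* d_n^T(K, nrm) for the system of characters chi, whose set of frequencies
   is I; nrm is the functional that defines the (quasi)norm of X. *)
Definition trig_width {R : realType} {I : choiceType} {X : Type}
    (chi : I -> X -> R[i]) (nrm : (X -> R[i]) -> \bar R) (n : nat)
    (K : set (X -> R[i])) : \bar R :=
  ereal_inf [set
    ereal_sup [set
      ereal_inf [set nrm (fun x => f x - g x) | g in char_span chi Lambda]
    | f in K]
  | Lambda in [set Lambda : {fset I} | (#|` Lambda| <= n)%N]].

(* Main.v *)
Require Import Defs.
From HB Require Import structures.
From mathcomp Require Import all_boot all_order all_algebra finmap.
From mathcomp Require Import all_classical all_reals all_analysis.
From mathcomp Require Import complex measurable_realfun.
From mathcomp Require Import zify ring lra.

Set Implicit Arguments.
Unset Strict Implicit.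
Unset Printing Implicit Defensive.

Import Order.TTheory GRing.Theory Num.Theory.
Import numFieldNormedType.Exports.

Local Open Scope classical_set_scope.
Local Open Scope ring_scope.

(** For p < 1 a function of mean 1 can have a tiny L_p quasinorm, provided its
    mass sits on a small set.  The Fejer kernel
    F_K(z) = |1 + z + ... + z^(K-1)|^2 / K, a combination of the z^t with
    |t| < K whose constant coefficient is 1, is of this kind.  Hence, for
    characters chi_k and chi_v, the product chi_k F_K(chi_v) is small in L_p,
    and chi_k minus this product is a combination of the chi_(k + t v) with
    0 < |t| < K: the character chi_k is close to the span of its neighbours in
    an arithmetic progression around k.

    It remains to find a sparse set Lambda such that through every k with
    |k| <= N passes a progression whose other 2K - 2 terms lie in Lambda.  Put
    r = K - 1, q = 2r + 1 and q^m > 2N, and let Lambda consist of the integers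
    whose m balanced digits (the digits in -r, ..., r to base q) are all
    nonzero.  Given k, let v be the sum of the q^i over the positions i at
    which the digit of k is 0.
    Adding t v with 0 < |t| <= r turns exactly these digits into t, so that
    k + t v is in Lambda (zero_free_direction).  Balanced digits are essential:
    a progression on one side of k would not do, since an analytic polynomial
    has L_p quasinorm at least the modulus of its constant term.

    Lambda has (2r)^m = q^m (1 - 1/q)^m <= q^m exp(-m/q) elements, and m is
    about ln N / ln q.  With q a small power of ln N the factor exp(-m/q)
    beats any exp(-(ln N)^c) with c small (zero_free_parameters), while
    the error, a negative power of K, is a negative power of ln N
    (fejer_powR_le, error_powR_le).

    The circle and the cyclic group are treated together, for a group of
    frequencies I and a unimodular system chi that is multiplicative in the
    frequency (trig_width_zero_free).  The only analytic input is the
    orthogonality of characters: nontrivial ones have mean zero.  On the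
    cyclic group some t v with 0 < |t| <= r may vanish modulo N; then
    chi_k = chi_(k + t v) already belongs to the span, and otherwise all these
    frequencies are nontrivial and the argument above applies. *)

(** * The Fejer kernel on the unit circle *)

Local Notation normc := (@Normc.normc _).

Definition geom {R : realType} (K : nat) (z : R[i]) : R[i] :=
  \sum_(s < K) z ^+ s.

Definition fejer {R : realType} (K : nat) (z : R[i]) : R :=
  normc (geom K z) ^+ 2 / K%:R.

Section Fejer.
Variable R : realType.
Implicit Types (z : R[i]) (K L : nat).

Lemma normc_ge0 z : 0 <= normc z.
Proof. by case: z => a b; rewrite sqrtr_ge0. Qed.

Lemma fejer_ge0 K z : 0 <= fejer K z.
Proof. by rewrite divr_ge0 ?sqr_ge0. Qed.

Lemma normcX z s : normc (z ^+ s) = normc z ^+ s.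
Proof.
elim: s => [|s IHs]; first by rewrite !expr0 Normc.normc1.
by rewrite !exprS Normc.normcM IHs.
Qed.

Lemma normc_sum (I : Type) (r : seq I) (F : I -> R[i]) :
  normc (\sum_(i <- r) F i) <= \sum_(i <- r) normc (F i).
Proof.
elim: r => [|i r IHr]; first by rewrite !big_nil Normc.normc0.
by rewrite !big_cons (le_trans (le_normcD _ _)) ?lerD2l.
Qed.

(** Summing the geometric series, (z - 1) geom K z = z^K - 1, which has modulus
    at most 2.  This bounds the kernel away from z = 1. *)
Lemma fejer_mul_le K z : (0 < K)%N -> normc z = 1 ->
  fejer K z * normc (z - 1) ^+ 2 <= 4 / K%:R.
Proof.
move=> K_gt0 z1; rewrite /fejer mulrAC ler_pM2r ?invr_gt0 ?ltr0n// -exprMn.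
have -> : (4 : R) = 2 ^+ 2 by rewrite -natrX.
rewrite lerXn2r ?nnegrE ?mulr_ge0 ?normc_ge0//.
rewrite -Normc.normcM mulrC /geom -subrX1.
apply: le_trans (le_normcD _ _) _.
by rewrite normcX z1 expr1n normcN Normc.normc1.
Qed.

Lemma normc_expB1_le z s : normc z = 1 ->
  normc (z ^+ s - 1) <= s%:R * normc (z - 1).
Proof.
move=> z1; elim: s => [|s IHs].
  by rewrite expr0 subrr Normc.normc0 mul0r.
have -> : z ^+ s.+1 - 1 = z * (z ^+ s - 1) + (z - 1).
  by rewrite exprS mulrBr mulr1 addrA subrK.
apply: le_trans (le_normcD _ _) _.
by rewrite Normc.normcM z1 mul1r -natr1 mulrDl mul1r lerD2r.
Qed.

(** Near 1 the powers z^s with s < L all stay within L |z - 1| <= 1/2 of 1, so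
    there is no cancellation.  Read backwards, this bounds the measure of a
    neighbourhood of 1 by means of the integral of a Fejer kernel, so that no
    set ever has to be measured. *)
Lemma fejer_ge_near1 L z : (0 < L)%N -> normc z = 1 ->
  normc (z - 1) <= (2 * L%:R)^-1 -> L%:R <= 4 * fejer L z.
Proof.
move=> L_gt0 z1 zB1; have L0 : 0 < L%:R :> R by rewrite ltr0n.
have dist : normc (\sum_(s < L) (z ^+ s - 1)) <= L%:R / 2.
  apply: le_trans (normc_sum _ _) _.
  apply: (@le_trans _ _ (\sum_(s < L) (L%:R * (2 * L%:R)^-1))).
    apply: ler_sum => s _; apply: le_trans (normc_expB1_le _ z1) _.
    by rewrite ler_pM ?normc_ge0// ler_nat ltnW.
  rewrite sumr_const card_ord -[_ *+ L]mulr_natl.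
  by rewrite le_eqVlt; apply/orP; left; apply/eqP; field; lra.
have half : L%:R / 2 <= normc (geom L z).
  have : normc (L%:R : R[i]) <=
      normc (geom L z) + normc (- \sum_(s < L) (z ^+ s - 1)).
    apply: le_trans (le_normcD _ _).
    by rewrite /geom sumrB opprB addrCA subrr addr0 sumr_const card_ord.
  have -> : normc (L%:R : R[i]) = L%:R by rewrite normcMn Normc.normc1.
  by rewrite normcN => /le_trans/(_ (lerD (lexx _) dist)); lra.
rewrite /fejer mulrA ler_pdivlMr//.
have : (L%:R / 2) ^+ 2 <= normc (geom L z) ^+ 2.
  by rewrite lerXn2r ?nnegrE ?divr_ge0 ?normc_ge0.
by rewrite !expr2; lra.
Qed.

(** A concave power of the kernel is dominated by an affine function of two
    kernels; since these have mean 1, integration shows that the p-th power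
    has mean at most L^(-p) + 5 L^(p-1).  Where F_K <= 1/L the first term
    suffices.  Elsewhere z is so close to 1 that 4 F_L >= L: if F_K <= L then
    F_K^p <= L^p <= L^(p-1) (4 F_L), and if F_K > L then
    F_K^p = F_K^(p-1) F_K <= L^(p-1) F_K. *)
Lemma fejer_powR_le (p : R) K L z :
  0 < p < 1 -> (0 < L)%N -> K = (16 * L ^ 3)%N -> normc z = 1 ->
  fejer K z `^ p <=
    L%:R `^ (- p) + L%:R `^ (p - 1) * (4 * fejer L z + fejer K z).
Proof.
move=> /andP[p_gt0 p_lt1] L_gt0 KE z1.
have L0 : 0 < L%:R :> R by rewrite ltr0n.
have K_gt0 : (0 < K)%N by rewrite KE muln_gt0 expn_gt0 L_gt0.
have fK := fejer_ge0 K z; have fL := fejer_ge0 L z.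
have a0 := powR_ge0 (L%:R : R) (p - 1).
have [small|big] := lerP (fejer K z) L%:R^-1.
  apply: (@le_trans _ _ (L%:R `^ (- p))).
    have -> : L%:R `^ (- p) = L%:R^-1 `^ p.
      by rewrite -powR_inv1 ?ltW// -powRrM mulN1r.
    by apply: (ge0_ler_powR (ltW p_gt0)) => //; rewrite nnegrE invr_ge0 ltW.
  by rewrite lerDl mulr_ge0// addr_ge0// mulr_ge0.
apply: (@le_trans _ _ (L%:R `^ (p - 1) * (4 * fejer L z + fejer K z)));
  last first.
  by rewrite lerDr powR_ge0.
(* |z - 1|^2 <= L * (4 / K) = (2 L)^(-2): this is where K = 16 L^3 is used. *)
have near1 : normc (z - 1) <= (2 * L%:R)^-1.
  rewrite -(@ler_pXn2r _ 2%N) ?nnegrE ?normc_ge0 ?invr_ge0 ?mulr_ge0//.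
  have /le_trans H := ler_wpM2r (sqr_ge0 (normc (z - 1))) (ltW big).
  have {H} := H _ (fejer_mul_le K_gt0 z1).
  rewrite mulrC ler_pdivrMr// => /le_trans; apply.
  rewrite KE natrM natrX le_eqVlt; apply/orP; left; apply/eqP.
  by field; lra.
have gL := fejer_ge_near1 L_gt0 z1 near1.
have powE x : 0 < x -> x `^ p = x `^ (p - 1) * x :> R.
  move=> x0; rewrite -[X in _ * X]powRr1 ?ltW// -powRD ?subrK//.
  by rewrite gt_eqF ?implybT.
have [fle|fgt] := lerP (fejer K z) L%:R.
  apply: (@le_trans _ _ (L%:R `^ p)).
    by apply: (ge0_ler_powR (ltW p_gt0)) => //; rewrite nnegrE ltW.
  by rewrite powE// ler_wpM2l//; lra.
have f0 : 0 < fejer K z by apply: lt_trans fgt.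
rewrite powE// ler_pM ?powR_ge0 ?(ltW f0)//; last by lra.
rewrite -[p - 1]opprB !powRN lef_pV2 ?posrE ?powR_gt0//.
by apply: ge0_ler_powR; rewrite ?nnegrE ?subr_ge0 ?ltW.
Qed.
End Fejer.

(** * Integers without the digit zero *)

Section ZeroFreeIntegers.

Definition nonzero_digits (r : nat) : seq int :=
  [seq t.+1%:Z | t <- iota 0 r] ++ [seq - t.+1%:Z | t <- iota 0 r].

(** The integers with m balanced digits to base 2 r + 1, none of them 0; the
    head digit d of the recursion is the least significant one. *)
Fixpoint zero_free (r m : nat) : seq int :=
  if m is m'.+1 then
    [seq d + (2 * r + 1)%N%:Z * l | d <- nonzero_digits r, l <- zero_free r m']
  else [:: 0].

Lemma size_zero_free r m : size (zero_free r m) = ((2 * r) ^ m)%N.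
Proof.
elim: m => [//|m IHm] /=.
by rewrite size_allpairs IHm size_cat !size_map size_iota addnn -mul2n expnS.
Qed.

Lemma mem_nonzero_digits r (d : int) :
  (0 < `|d| <= r)%N -> d \in nonzero_digits r.
Proof.
rewrite mem_cat => /andP[d0 dr]; apply/orP.
case: d d0 dr => [[//|t]|t] _ tr; [left|right]; apply/mapP; exists t => //;
  by rewrite mem_iota; lia.
Qed.

(** Euclidean division of k + r, which shifts the remainders to -r, ..., r. *)
Lemma balanced_digit (r : nat) (k : int) :
  exists d k' : int, (`|d| <= r)%N /\ k = d + (2 * r + 1)%N%:Z * k'.
Proof.
pose q : int := (2 * r + 1)%N%:Z; have q0 : 0 < q by rewrite /q; lia.
have qn0 : q != 0 by rewrite gt_eqF.
exists (modz (k + r%:Z) q - r%:Z), (divz (k + r%:Z) q).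
have E := divz_eq (k + r%:Z) q.
have := modz_ge0 (k + r%:Z) qn0; have := ltz_pmod (k + r%:Z) q0.
by rewrite -/q [q * _]mulrC; move: E; rewrite {3 5 6}/q; split; lia.
Qed.

(** The direction v has digit 1 at the positions where k has digit 0, and digit
    0 elsewhere.  Then k + t v has the digits t and those nonzero digits of k,
    without carries.  If k is itself free of zeros, then v = 0. *)
Lemma zero_free_direction r m (k : int) : (2 * `|k| < (2 * r + 1) ^ m)%N ->
  exists v : int, forall t : int, (0 < `|t| <= r)%N ->
    k + t * v \in zero_free r m.
Proof.
elim: m k => [|m IHm] k; rewrite ?expn0 ?expnS => km.
  by exists 0 => t _; rewrite mulr0 addr0 mem_seq1; lia.
have [d [k' [dr kE]]] := balanced_digit r k.
have odd_q : odd ((2 * r + 1) ^ m) by rewrite oddX addn1/= oddM orbT.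
(* The bound on k' is 2 |k'| <= q^m at first; equality is excluded by parity. *)
have k'm : (2 * `|k'| < (2 * r + 1) ^ m)%N.
  have bound : ((2 * r + 1) * `|k'| <= `|k| + r)%N.
    have -> : ((2 * r + 1) * `|k'|)%N = absz ((2 * r + 1)%N%:Z * k').
      by rewrite abszM.
    by lia.
  have : (2 * `|k'| <= (2 * r + 1) ^ m)%N by nia.
  by rewrite leq_eqVlt => /orP[/eqP E|//]; rewrite -E oddM in odd_q.
have [v Hv] := IHm _ k'm.
exists ((d == 0)%:R + (2 * r + 1)%N%:Z * v) => t tr.
have -> : k + t * ((d == 0)%:R + (2 * r + 1)%N%:Z * v) =
    (d + t * (d == 0)%:R) + (2 * r + 1)%N%:Z * (k' + t * v).
  by rewrite kE; ring.
apply: allpairs_f; last exact: Hv.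
apply: mem_nonzero_digits.
by case: eqVneq => [->|d0]; rewrite ?mulr1 ?mulr0 ?add0r ?addr0//; lia.
Qed.

End ZeroFreeIntegers.

(** * Character systems, and the approximation of a character *)

Section CharSpan.
Variables (R : realType) (I : choiceType) (X : Type) (chi : I -> X -> R[i]).
Variable Lambda : {fset I}.

Lemma char_span_char k : k \in Lambda -> char_span chi Lambda (chi k).
Proof.
move=> kL; exists (fun j => (j == k)%:R); apply/funext => x.
rewrite (big_fsetD1 k)//= eqxx mul1r big_seq_cond big1 ?addr0// => j.
by rewrite in_fsetD1 andbT => /andP[/negPf-> _]; rewrite mul0r.
Qed.

Lemma char_spanZ c f : char_span chi Lambda f ->
  char_span chi Lambda (fun x => c * f x).
Proof.
move=> [a ->]; exists (fun k => c * a k); apply/funext => x.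
by rewrite mulr_sumr; apply: eq_bigr => k _; rewrite mulrA.
Qed.

Lemma char_spanD f g : char_span chi Lambda f -> char_span chi Lambda g ->
  char_span chi Lambda (fun x => f x + g x).
Proof.
move=> [a ->] [b ->]; exists (fun k => a k + b k); apply/funext => x.
by rewrite -big_split; apply: eq_bigr => k _; rewrite mulrDl.
Qed.

Lemma char_span_sum (J : Type) (s : seq J) (P : pred J) (F : J -> X -> R[i]) :
  (forall j, P j -> char_span chi Lambda (F j)) ->
  char_span chi Lambda (fun x => \sum_(j <- s | P j) F j x).
Proof.
move=> FL; elim: s => [|j s IHs].
  exists (fun=> 0); apply/funext => x; rewrite big_nil big1// => k _.
  by rewrite mul0r.
case: (boolP (P j)) => [Pj|/negPf nPj].
  have := char_spanD (FL j Pj) IHs; congr (char_span _ _ _).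
  by apply/funext => x; rewrite big_cons Pj.
by move: IHs; congr (char_span _ _ _); apply/funext => x; rewrite big_cons nPj.
Qed.

End CharSpan.

Section CharacterSystem.
Variables (R : realType) (I : zmodType) (X : Type) (chi : I -> X -> R[i]).
Hypothesis chiD : forall a b x, chi (a + b) x = chi a x * chi b x.
Hypothesis normc_chi : forall a x, normc (chi a x) = 1.

(** A trigonometric polynomial f with constant term c.  Keeping the polynomial,
    and not just the value of an integral, makes one argument serve every
    mean value for which nontrivial characters have mean zero; on the circle
    it also provides continuity. *)
Definition has_mean (f : X -> R) (c : R) := exists s : seq (R * I),
  all (fun j => j.2 != 0) s /\
  forall x, f x = c + \sum_(j <- s) j.1 * complex.Re (chi j.2 x).

Lemma has_mean_cst c : has_mean (fun=> c) c.
Proof. by exists [::]; split=> // x; rewrite big_nil addr0. Qed.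

Lemma has_meanD f g c d : has_mean f c -> has_mean g d ->
  has_mean (fun x => f x + g x) (c + d).
Proof.
move=> [s [s0 fE]] [t [t0 gE]]; exists (s ++ t); split=> [|x].
  by rewrite all_cat s0.
by rewrite fE gE big_cat/= addrACA.
Qed.

Lemma has_meanZ a f c : has_mean f c -> has_mean (fun x => a * f x) (a * c).
Proof.
move=> [s [s0 fE]]; exists [seq (a * j.1, j.2) | j <- s]; split=> [|x].
  by rewrite all_map.
rewrite fE big_map mulrDr mulr_sumr; congr (_ + _).
by apply: eq_bigr => j _ /=; rewrite mulrA.
Qed.

Lemma chi0 x : chi 0 x = 1.
Proof.
have chi_neq0 : chi 0 x != 0.
  apply/eqP => E; have := normc_chi 0 x; rewrite E Normc.normc0 => /esym/eqP.
  by rewrite oner_eq0.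
by apply: (mulfI chi_neq0); rewrite mulr1 -chiD addr0.
Qed.

Lemma chiMn v s x : chi (v *+ s) x = chi v x ^+ s.
Proof.
elim: s => [|s IHs]; first by rewrite mulr0n expr0 chi0.
by rewrite mulrS exprS chiD IHs.
Qed.

Lemma chiN v x : chi (- v) x = conjc (chi v x).
Proof.
have H : chi v x * conjc (chi v x) = 1.
  rewrite -sqr_normc -[Num.norm _]/((normc (chi v x))%:C%C) normc_chi.
  by rewrite rmorph1 expr1n.
have chi_neq0 : chi v x != 0.
  by apply/eqP => E; move: H; rewrite E mul0r => /esym/eqP; rewrite oner_eq0.
by apply: (mulfI chi_neq0); rewrite H -chiD subrr chi0.
Qed.

Lemma fejer_chi K v x : ((fejer K (chi v x))%:C)%C =
  K%:R^-1 * \sum_(p : 'I_K * 'I_K) chi (v *+ p.1 - v *+ p.2) x.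
Proof.
rewrite /fejer rmorphM fmorphV rmorph_nat rmorphXn/= mulrC; congr (_ * _).
rewrite -[((normc _)%:C)%C]/(`|geom K (chi v x)|) sqr_normc /geom rmorph_sum/=.
rewrite big_distrlr/= pair_big/=; apply: eq_bigr => p _.
by rewrite chiD chiN !chiMn !rmorphXn.
Qed.

(** The diagonal pairs contribute the constant term 1 of the kernel. *)
Lemma fejer_chi_split K v x : (0 < K)%N -> ((fejer K (chi v x))%:C)%C = 1 +
  K%:R^-1 * \sum_(p : 'I_K * 'I_K | p.1 != p.2) chi (v *+ p.1 - v *+ p.2) x.
Proof.
move=> K_gt0; rewrite fejer_chi (bigID (fun p => p.1 == p.2))/= mulrDr.
congr (_ + _).
rewrite -(pair_big_dep xpredT (fun i j => i == j)
  (fun i j : 'I_K => chi (v *+ i - v *+ j) x))/=.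
under eq_bigr do rewrite (big_pred1 _ (fun j => eq_sym _ j)) subrr chi0.
by rewrite sumr_const card_ord mulVf// pnatr_eq0 -lt0n.
Qed.

Lemma Re_sum (J : Type) (s : seq J) (P : pred J) (F : J -> R[i]) :
  complex.Re (\sum_(j <- s | P j) F j) = \sum_(j <- s | P j) complex.Re (F j).
Proof. by apply: (big_morph (@complex.Re R)) => // -[a b] [c d]. Qed.

(** A multiple of v that vanishes in I would turn another term of the kernel
    into a constant, whence the hypothesis on v. *)
Lemma has_mean_fejer K v : (0 < K)%N ->
  (forall t, (0 < t < K)%N -> v *+ t != 0) ->
  has_mean (fun x => fejer K (chi v x)) 1.
Proof.
move=> K_gt0 v_free.
exists [seq (K%:R^-1, v *+ p.1 - v *+ p.2) | p : 'I_K * 'I_K <-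
  [seq p <- index_enum _ | p.1 != p.2]]; split=> [|x].
  apply/allP => _ /mapP[[a b] + ->] /=; rewrite mem_filter/= => /andP[ab _].
  wlog lt_ab : a b ab / (b < a)%N.
    move=> H; have [/H|/H|/val_inj E] := ltngtP b a; first exact.
      by rewrite eq_sym => /(_ ab); rewrite -oppr_eq0 opprB.
    by rewrite E eqxx in ab.
  rewrite -mulrnBr ?(ltnW lt_ab)//; apply: v_free.
  by rewrite subn_gt0 lt_ab (leq_ltn_trans (leq_subr _ _)).
have := fejer_chi_split v x K_gt0 => /(congr1 (@complex.Re R)) /= ->.
have -> : (K%:R^-1 : R[i]) = ((K%:R^-1)%:C)%C by rewrite fmorphV rmorph_nat.
have ReM (c : R) (z : R[i]) : complex.Re ((c%:C)%C * z) = c * complex.Re z.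
  by case: z => a b /=; rewrite mul0r subr0.
have ReD (y z : R[i]) : complex.Re (y + z) = complex.Re y + complex.Re z.
  by case: y z => [? ?] [].
by rewrite ReD ReM Re_sum big_map big_filter/= mulr_sumr.
Qed.

Section Approximation.
Variables (nrm : (X -> R[i]) -> \bar R) (p : R).
Hypothesis p01 : 0 < p < 1.
(** What is used of the L_p quasinorm: it is monotone, and the mean of a
    trigonometric polynomial is its constant term. *)
Hypothesis nrm_le : forall (h : X -> R[i]) (G : X -> R) (c d : R),
  has_mean (fun x => normc (h x)) c -> has_mean G d ->
  (forall x, normc (h x) `^ p <= G x) -> (nrm h <= (d `^ p^-1)%:E)%E.

Lemma nrm_mul_fejer_le (k v : I) (K L : nat) :
  (0 < L)%N -> K = (16 * L ^ 3)%N ->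
  (forall t, (0 < t < K)%N -> v *+ t != 0) ->
  (nrm (fun x => (chi k x * ((fejer K (chi v x))%:C)%C)%R)
    <= ((L%:R `^ (- p) + L%:R `^ (p - 1) * 5) `^ p^-1)%:E)%E.
Proof.
move=> L_gt0 KE v_free.
have K_gt0 : (0 < K)%N by rewrite KE muln_gt0 expn_gt0 L_gt0.
have LK : (L <= K)%N by rewrite KE; nia.
have mK := has_mean_fejer K_gt0 v_free.
have mL : has_mean (fun x => fejer L (chi v x)) 1.
  apply: has_mean_fejer => // t /andP[t0 tL]; apply: v_free.
  by rewrite t0 (leq_trans tL).
have normE x : normc (chi k x * ((fejer K (chi v x))%:C)%C) =
    fejer K (chi v x).
  rewrite Normc.normcM normc_chi mul1r /= expr0n/= addr0 sqrtr_sqr.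
  by rewrite ger0_norm// fejer_ge0.
have -> : (5 : R) = 4 * 1 + 1 by rewrite mulr1 -(natrD _ 4 1).
apply: (nrm_le (c := 1) (G := fun x => L%:R `^ (- p) +
  L%:R `^ (p - 1) * (4 * fejer L (chi v x) + fejer K (chi v x)))).
- by under eq_fun do rewrite normE.
- apply: has_meanD; first exact: has_mean_cst.
  by apply: has_meanZ; apply: has_meanD => //; exact: has_meanZ.
- by move=> x; rewrite normE; apply: fejer_powR_le.
Qed.

Lemma nrm0_le (d : R) : 0 <= d -> (nrm (fun=> 0%R) <= (d `^ p^-1)%:E)%E.
Proof.
move=> d0; apply: (nrm_le (c := 0) (G := fun=> d)).
- by rewrite (_ : (fun=> _) = fun=> 0) ?Normc.normc0//; exact: has_mean_cst.
- exact: has_mean_cst.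
- by move=> x; rewrite Normc.normc0 powR0// gt_eqF//; case/andP: p01.
Qed.

(** The constant term of the kernel cancels chi_k; what remains only involves
    the other terms of the progression k + t v. *)
Lemma fejer_error_span (Lambda : {fset I}) (k v : I) (K : nat) : (0 < K)%N ->
  (forall t : int, (0 < `|t| < K)%N -> k + v *~ t \in Lambda) ->
  char_span chi Lambda
    (fun x => chi k x - chi k x * ((fejer K (chi v x))%:C)%C).
Proof.
move=> K_gt0 kvL.
rewrite (_ : (fun x => _) = fun x => - K%:R^-1 *
    \sum_(p : 'I_K * 'I_K | p.1 != p.2) chi (k + (v *+ p.1 - v *+ p.2)) x).
  apply/char_spanZ/char_span_sum => -[a b] /= ab; apply: char_span_char.
  have -> : v *+ a - v *+ b = v *~ (a%:Z - b%:Z) by rewrite mulrzBr.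
  apply: kvL; have := ltn_ord a; have := ltn_ord b.
  have : (a : nat) != b by [].
  by move: (a : nat) (b : nat) => {ab} a' b'; lia.
apply/funext => x; rewrite fejer_chi_split// mulrDr mulr1 opprD addrA subrr.
rewrite add0r mulrCA mulNr mulr_sumr; congr (- (_ * _)).
by apply: eq_bigr => q _; rewrite -chiD.
Qed.

(** The frequencies are the images of the zero-free integers under l |-> l g.
    For a given k, with v the direction of zero_free_direction, either the
    progression returns to k g before its end, and then k g is one of these
    frequencies, or the Fejer kernel in the direction v g gives the
    approximation. *)
Lemma trig_width_zero_free (g : I) (L r m n N : nat) :
  (0 < L)%N -> r.+1 = (16 * L ^ 3)%N ->
  (2 * N < (2 * r + 1) ^ m)%N -> ((2 * r) ^ m <= n)%N ->
  (trig_width chi nrm n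
    [set chi (g *~ k) | k in [set k : int | (- N%:Z <= k <= N%:Z)%R]]
   <= ((L%:R `^ (- p) + L%:R `^ (p - 1) * 5) `^ p^-1)%:E)%E.
Proof.
move=> L_gt0 rE Nm rn.
pose Lambda := [fset g *~ l | l in zero_free r m]%fset.
have LambdaP l : l \in zero_free r m -> g *~ l \in Lambda.
  by move=> lz; apply/imfsetP; exists l.
apply: ge_ereal_inf; eexists.
  exists Lambda; last reflexivity.
  rewrite /= (leq_trans _ rn)// -size_zero_free.
  apply: leq_trans (leq_imfset_card _ _ _) _.
  by rewrite /= size_undup.
apply: ge_ereal_sup => _ [_ [k kN <-] <-].
have kN' : (2 * `|k| < (2 * r + 1) ^ m)%N.
  apply: leq_ltn_trans Nm; rewrite leq_mul2l/=.
  by move: kN => /= ; lia.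
have [v kv] := zero_free_direction kN'.
have r0 : (0 < r)%N by nia.
apply: ge_ereal_inf.
have [[t /andP[t0 tr] vt]|v_free] :=
    pselect (exists2 t, (0 < t < r.+1)%N & (g *~ v) *+ t = 0).
  exists (nrm (fun x => chi (g *~ k) x - chi (g *~ k) x)).
    exists (chi (g *~ k)) => //; apply: char_span_char.
    have -> : g *~ k = g *~ (k + t%:Z * v).
      by rewrite mulrzDr -mulrzA_C [(g *~ v) *~ _]vt addr0.
    by apply/LambdaP/kv; rewrite absz_nat t0.
  under eq_fun do rewrite subrr.
  by apply: nrm0_le; rewrite addr_ge0 ?mulr_ge0 ?powR_ge0.
exists (nrm (fun x => chi (g *~ k) x -
  (chi (g *~ k) x - chi (g *~ k) x * ((fejer r.+1 (chi (g *~ v) x))%:C)%C))).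
  eexists; last reflexivity.
  apply: fejer_error_span => // t tr.
  rewrite mulrzA_C -mulrzDr; exact/LambdaP/kv.
under eq_fun do rewrite subKr.
apply: nrm_mul_fejer_le => // t tr; apply/eqP => vt.
by apply: v_free; exists t.
Qed.

End Approximation.
End CharacterSystem.

(** * The circle *)

Section Exponential.
Variable R : realType.
Implicit Types t : R.

Lemma eD t u : e (t + u) = e t * e u.
Proof.
apply/eqP; rewrite eq_complex /= mulrDr cosD sinD eqxx/=.
by rewrite [X in X == _]addrC.
Qed.

Lemma normc_e t : normc (e t) = 1.
Proof. by rewrite /e /= cos2Dsin2 sqrtr1. Qed.

Lemma e_nat (m : nat) : e m%:R = 1 :> R[i].
Proof.
elim: m => [|m IHm]; first by rewrite /e mulr0 cos0 sin0.
rewrite -natr1 eD IHm mul1r /e mulr1 mulr_natl.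
by rewrite cos2pi sin2pi.
Qed.

Lemma e_int (k : int) : e k%:~R = 1 :> R[i].
Proof.
case: k => m; first exact: e_nat.
rewrite NegzE rmorphN/=; have : e (- m.+1%:R + m.+1%:R : R) = 1.
  by rewrite addNr; exact: (e_nat 0).
by rewrite eD e_nat mulr1.
Qed.

Lemma e_neq1 t : 0 < t < 1 -> e t != 1.
Proof.
move=> /andP[t0 t1]; rewrite eq_complex/= negb_and; apply/orP; left.
rewrite lt_eqF// -mulrA mulr_natl cos_mulr2n cos2sin2.
have : 0 < sin (pi * t).
  apply: sin_gt0_pi; rewrite mulr_gt0 ?pi_gt0//=.
  by rewrite gtr_pMr ?pi_gt0.
by move=> /(mulr_gt0) H; have := H _ (H _ ltr01); rewrite mulr1 expr2; lra.
Qed.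

End Exponential.

Section Torus.
Variable R : realType.
Local Notation mu := (@lebesgue_measure R).

Lemma char_torusD (a b : int) (x : R) :
  char_torus (a + b) x = char_torus a x * char_torus b x.
Proof. by rewrite /char_torus rmorphD mulrDl eD. Qed.

Lemma normc_char_torus (a : int) (x : R) : normc (char_torus a x) = 1.
Proof. exact: normc_e. Qed.

Lemma continuous_Re_char_torus (k : int) :
  continuous (fun x : R => complex.Re (char_torus k x)).
Proof.
rewrite (_ : (fun x : R => _) = cos \o ( *%R (2 * pi * k%:~R))); last first.
  by apply/funext => x; rewrite /= mulrA.
move=> x; apply: continuous_comp; last exact: continuous_cos.
exact: mulrl_continuous.
Qed.

(** The integral over a period is computed from an explicit primitive: the
    nonconstant terms integrate to multiples of sin (2 pi k x), which vanish
    at both 0 and 1. *)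
Lemma has_mean_torus_primitive (f : R -> R) (c : R) :
  has_mean (@char_torus R) f c ->
  continuous f /\ exists F : R -> R,
    (forall x, is_derive x (1 : R) F (f x)) /\ F 1 - F 0 = c.
Proof.
move=> [s [s0 fE]]; elim: s f s0 fE => [|[a k] s IHs] f.
  move=> _ fE; have -> : f = cst c.
    by apply/funext => x; rewrite fE big_nil addr0.
  split; first exact: cst_continuous.
  exists (fun x => c * x); split=> [x|]; last by rewrite mulr1 mulr0 subr0.
  by apply: is_derive_eq; rewrite [_%:A]mulr1.
move=> /andP[/= k0 s0] fE.
have [cg [G [dG Gc]]] := IHs _ s0 (fun=> erefl).
set g := (fun x => _) in cg dG.
have -> : f = fun x => a * complex.Re (char_torus k x) + g x.
  by apply/funext => x; rewrite fE big_cons/= addrCA.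
have k0' : (k%:~R : R) != 0 by rewrite intr_eq0.
have pi0 : (pi : R) != 0 by rewrite gt_eqF// pi_gt0.
split.
  move=> x; apply: cvgD; last exact: cg.
  by apply: cvgM; [exact: cvg_cst|exact: continuous_Re_char_torus].
exists (fun x => a / (2 * pi * k%:~R) * sin (2 * pi * k%:~R * x) + G x).
split=> [x|].
  apply: is_derive_eq.
  rewrite /g /=; congr (_ + _).
  rewrite -[LHS]/(_ * (_ * (_ * 1))).
  rewrite [2 * pi * (k%:~R * x)]mulrA; set C := cos _.
  by move: pi0 C; move: (pi : R) => P P0 C; field; rewrite k0'.
have sin_k : sin (2 * pi * k%:~R * 1 : R) = 0.
  by have /(congr1 (@complex.Im R)) := e_int R k; rewrite mulr1.
by rewrite sin_k !mulr0 sin0 !mulr0 !add0r.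
Qed.

Lemma has_mean_integral_torus (f : R -> R) (c : R) :
  has_mean (@char_torus R) f c ->
  (\int[mu]_(x in `[0%R, 1%R[) (f x)%:E = c%:E)%E.
Proof.
move=> /has_mean_torus_primitive[cf [F [dF <-]]].
have cF x : F y @[y --> x] --> F x.
  by apply/differentiable_continuous/derivable1_diffP; case: (dF x).
rewrite integral_itv_bndo_bndc; last first.
  apply/measurable_EFinP; apply: measurable_funTS.
  exact: continuous_measurable_fun.
rewrite (@continuous_FTC2 _ f F)// ?EFinB//.
- exact: continuous_subspaceT.
- split; last 2 first.
  + exact: cvg_at_right_filter.
  + exact: cvg_at_left_filter.
  by move=> x _; case: (dF x).
- by move=> x _; rewrite derive1E; case: (dF x).
Qed.

Lemma Lp_torus_le (p : R) (h : R -> R[i]) (G : R -> R) (c d : R) : 0 < p ->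
  has_mean (@char_torus R) (fun x => normc (h x)) c ->
  has_mean (@char_torus R) G d -> (forall x, normc (h x) `^ p <= G x) ->
  (Lp_torus p h <= (d `^ p^-1)%:E)%E.
Proof.
move=> p0 hc Gd hG.
have [ch _] := has_mean_torus_primitive hc.
have [cG _] := has_mean_torus_primitive Gd.
have le_d : (\int[mu]_(x in `[0%R, 1%R[) (normc (h x) `^ p)%:E <= d%:E)%E.
  rewrite -(has_mean_integral_torus Gd); apply: ge0_le_integral => //.
  - by move=> x _; rewrite lee_fin powR_ge0.
  - apply/measurable_EFinP; apply: measurable_funTS.
    apply: (measurableT_comp (measurable_powR p)).
    exact: continuous_measurable_fun.
  - apply/measurable_EFinP; apply: measurable_funTS.
    exact: continuous_measurable_fun.
  - by move=> x _; rewrite lee_fin.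
rewrite -poweR_EFin; apply: gt0_ler_poweR => //; first by rewrite invr_ge0 ltW.
  rewrite in_itv/= leey andbT; apply: integral_ge0 => x _.
  by rewrite lee_fin powR_ge0.
rewrite in_itv/= leey andbT; apply: le_trans le_d; apply: integral_ge0 => x _.
by rewrite lee_fin powR_ge0.
Qed.

End Torus.

(** * The cyclic group *)

Section Cyclic.
Variables (R : realType) (N : nat).
Hypothesis N_gt1 : (1 < N)%N.
Local Notation chi := (@char_cyclic R N).

Lemma e_modn (a b : nat) :
  e ((a %% N)%:R * b%:R / N%:R) = e (a%:R * b%:R / N%:R) :> R[i].
Proof.
have N0 : N%:R != 0 :> R by rewrite pnatr_eq0; lia.
rewrite {2}(divn_eq a N) natrD natrM.
have -> : ((a %/ N)%:R * N%:R + (a %% N)%:R) * b%:R / N%:R =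
    (a %/ N * b)%:R + (a %% N)%:R * b%:R / N%:R :> R.
  by rewrite natrM; field.
by rewrite eD e_nat mul1r.
Qed.

Lemma val_ZpD (a b : 'Z_N) : (a + b : 'Z_N) = ((a + b)%N %% N)%N :> nat.
Proof. by rewrite /=; congr (_ %% _)%N; exact: Zp_cast. Qed.

Lemma char_cyclicD (a b x : 'Z_N) : chi (a + b) x = chi a x * chi b x.
Proof. by rewrite /char_cyclic val_ZpD e_modn natrD !mulrDl eD. Qed.

Lemma char_cyclicC (a x : 'Z_N) : chi a x = chi x a.
Proof. by rewrite /char_cyclic [_ * (x : nat)%:R]mulrC. Qed.

Lemma normc_char_cyclic (a x : 'Z_N) : normc (chi a x) = 1.
Proof. exact: normc_e. Qed.

Lemma char_cyclic1_neq1 (k : 'Z_N) : k != 0 -> chi k 1 != 1.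
Proof.
move=> k0; rewrite /char_cyclic.
have -> : nat_of_ord (1 : 'Z_N) = 1%N by [].
have kN : (k < N)%N by rewrite -{2}(Zp_cast N_gt1) ltn_ord.
have k0' : (0 < k)%N by rewrite lt0n.
apply: e_neq1; rewrite mulr1 divr_gt0 ?ltr0n//=; last by lia.
by rewrite ltr_pdivrMr ?mul1r ?ltr_nat// ltr0n; lia.
Qed.

(** Translation by 1 permutes the group and multiplies the sum by
    chi k 1 <> 1. *)
Lemma sum_char_cyclic (k : 'Z_N) : k != 0 -> \sum_(x : 'Z_N) chi k x = 0.
Proof.
move=> /char_cyclic1_neq1 k1; set S := \sum_x _.
have : S * chi k 1 = S.
  rewrite {2}/S (reindex_inj (addIr (1 : 'Z_N))) mulr_suml.
  apply: eq_bigr => x _.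
  by rewrite [chi k (_ + _)]char_cyclicC char_cyclicD !(char_cyclicC _ k).
by move/eqP; rewrite -subr_eq0 -[X in _ - X]mulr1 -mulrBr mulf_eq0 subr_eq0
  (negPf k1) orbF => /eqP.
Qed.

Lemma has_mean_sum_cyclic (f : 'Z_N -> R) (c : R) : has_mean chi f c ->
  N%:R^-1 * \sum_(x : 'Z_N) f x = c.
Proof.
move=> [s [s0 fE]].
under eq_bigr do rewrite fE; rewrite big_split/= sumr_const card_ord.
rewrite [X in c *+ X](Zp_cast N_gt1) exchange_big/= big_seq big1 ?addr0.
  by rewrite -[c *+ N]mulr_natl mulKf// pnatr_eq0; lia.
move=> j js; rewrite -mulr_sumr.
have /(congr1 (@complex.Re R)) := sum_char_cyclic (allP s0 j js).
by rewrite Re_sum/= => ->; rewrite mulr0.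
Qed.

Lemma Lp_cyclic_le (p : R) (h : 'Z_N -> R[i]) (G : 'Z_N -> R) (d : R) :
  0 < p -> has_mean chi G d -> (forall x, normc (h x) `^ p <= G x) ->
  (Lp_cyclic p h <= (d `^ p^-1)%:E)%E.
Proof.
move=> p0 Gd hG; rewrite lee_fin.
have h0 : 0 <= N%:R^-1 * \sum_(x : 'Z_N) normc (h x) `^ p.
  by rewrite mulr_ge0 ?invr_ge0// sumr_ge0// => x _; exact: powR_ge0.
have le_d : N%:R^-1 * \sum_(x : 'Z_N) normc (h x) `^ p <= d.
  rewrite -(has_mean_sum_cyclic Gd) ler_wpM2l ?invr_ge0//.
  exact: ler_sum.
apply: ge0_ler_powR => //; rewrite ?invr_ge0 ?ltW// nnegrE//.
exact: le_trans le_d.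
Qed.

End Cyclic.

(** * Choice of the parameters *)

Section DigitCount.
Variable R : realType.

(** With w = (ln N)^(1/12), take L of order w, so that q = 2 r + 1 < 32 L^3
    is at most w^3 / 2, and let m be minimal with q^m > 2 N; then q^m <= 2 N q.
    From N < q^m <= exp(q m) follows m >= w^12 / q, hence
    (2 r)^m <= 2 N q exp(-m / q) <= N exp(2 q - 4 w^6) <= N exp(-w^3). *)
Lemma zero_free_parameters (N : nat) (w : R) : 8 <= w -> ln N%:R = w ^+ 12 ->
  exists L r m : nat, [/\ (0 < L)%N, r.+1 = (16 * L ^ 3)%N, w / 8 <= L%:R,
    (2 * N < (2 * r + 1) ^ m)%N &
    ((2 * r) ^ m)%N%:R <= N%:R * expR (- w ^+ 3)].
Proof.
move=> w8 lnN.
have w0 : 0 < w by lra.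
have N_gt0 : (0 < N)%N.
  case: N lnN => // /esym/eqP; rewrite ln0// expf_eq0 gt_eqF//.
have N0 : 0 < N%:R :> R by rewrite ltr0n.
pose L := Num.truncn (w / 4).
have /andP[Lw wL] : L%:R <= w / 4 < L.+1%:R by apply: truncn_itv; lra.
have L8 : w / 8 <= L%:R by move: wL; rewrite -[L.+1%:R]natr1; lra.
have L_gt0 : (0 < L)%N by rewrite -(ltr0n R); lra.
pose r := (16 * L ^ 3).-1.
have rE : r.+1 = (16 * L ^ 3)%N by rewrite prednK// muln_gt0 expn_gt0 L_gt0.
pose q := (2 * r + 1)%N.
have q_gt1 : (1 < q)%N by rewrite /q; lia.
have q0 : 0 < q%:R :> R by rewrite ltr0n; lia.
have qw : q%:R <= w ^+ 3 / 2.
  have : q.+1%:R = 32 * L%:R ^+ 3 :> R.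
    have -> : q.+1 = (32 * L ^ 3)%N by rewrite /q; lia.
    by rewrite natrM natrX.
  have : L%:R ^+ 3 <= (w / 4) ^+ 3 by rewrite lerXn2r ?nnegrE//; lra.
  by rewrite -[q.+1%:R]natr1 expr_div_n (_ : 4 ^+ 3 = 64 :> R); [lra|ring].
pose t := trunc_log q (2 * N); pose m := t.+1.
have /andP[qtN Nqm] : (q ^ t <= 2 * N < q ^ m)%N.
  by apply: trunc_log_bounds => //; rewrite muln_gt0.
exists L, r, m; split => //.
have mq : w ^+ 12 <= m%:R * q%:R.
  rewrite -lnN -ler_expR lnK ?posrE// expRM_natl.
  apply: (@le_trans _ _ ((q ^ m)%N%:R)); first by rewrite ler_nat; lia.
  rewrite natrX lerXn2r ?nnegrE ?expR_ge0 ?(ltW q0)//.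
  by apply: le_trans (expR_ge1Dx _); rewrite lerDr.
have decay : (2 * r)%N%:R <= q%:R * expR (- q%:R^-1) :> R.
  have := ler_wpM2l (ltW q0) (expR_ge1Dx (- q%:R^-1)).
  by rewrite mulrDr mulr1 mulrN mulfV ?gt_eqF// /q natrD addrK.
apply: (@le_trans _ _ ((q%:R * expR (- q%:R^-1)) ^+ m)).
  by rewrite natrX lerXn2r ?nnegrE ?mulr_ge0 ?expR_ge0 ?(ltW q0).
rewrite exprMn -expRM_natl.
apply: (@le_trans _ _ (q%:R * (2 * N%:R) * expR (m%:R * - q%:R^-1))).
  rewrite ler_wpM2r ?expR_ge0// exprS ler_wpM2l ?(ltW q0)//.
  by rewrite -natrX -natrM ler_nat.
have -> : q%:R * (2 * N%:R) * expR (m%:R * - q%:R^-1) =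
    N%:R * ((2 * q%:R) * expR (m%:R * - q%:R^-1)) :> R by ring.
rewrite ler_wpM2l ?(ltW N0)//.
apply: (@le_trans _ _ (expR (2 * q%:R) * expR (m%:R * - q%:R^-1))).
  rewrite ler_wpM2r ?expR_ge0//.
  by apply: le_trans (expR_ge1Dx _); rewrite lerDr.
rewrite -expRD ler_expR mulrN.
have mq' : 4 * w ^+ 6 <= m%:R / q%:R.
  rewrite ler_pdivlMr//; apply: (@le_trans _ _ (w ^+ 12 / q%:R)).
    rewrite ler_pdivlMr// -mulrA -expr2.
    apply: (@le_trans _ _ (4 * w ^+ 6 * (w ^+ 3 / 2) ^+ 2)).
      by rewrite ler_wpM2l ?mulr_ge0 ?exprn_ge0 ?lerXn2r ?nnegrE//; lra.
    by rewrite le_eqVlt; apply/orP; left; apply/eqP; field.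
  by rewrite ler_pdivrMr.
have : w ^+ 3 <= w ^+ 6 by rewrite ler_weXn2l//; lra.
have := exprn_gt0 6 w0.
lra.
Qed.

(** Both terms are at most L^(-s), so their sum is at most
    6 (w / 8)^(-s) <= 48 w^(-s).  Half of the exponent s is spent on absorbing
    the constant 48. *)
Lemma error_powR_le (p s w : R) (L : nat) : 0 < p ->
  0 < s -> s <= p -> s <= 1 - p -> 8 <= w -> 48 `^ (2 / s) <= w ->
  w / 8 <= L%:R ->
  (L%:R `^ (- p) + L%:R `^ (p - 1) * 5) `^ p^-1 <= w `^ (- (s / (2 * p))).
Proof.
move=> p0 s0 sp sp1 w8 wA wL.
have w0 : 0 < w by lra.
have L1 : 1 <= L%:R :> R by lra.
have Ls : L%:R `^ (- s) <= (w / 8) `^ (- s).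
  rewrite !powRN lef_pV2 ?posrE ?powR_gt0//; try lra.
  by apply: ge0_ler_powR; rewrite ?nnegrE; lra.
have Lp : L%:R `^ (- p) <= L%:R `^ (- s) by apply: ler_powR; lra.
have Lp1 : L%:R `^ (p - 1) <= L%:R `^ (- s) by apply: ler_powR; lra.
have w48 : 48 <= w `^ (s / 2).
  apply: (@le_trans _ _ ((48 `^ (2 / s)) `^ (s / 2))).
    rewrite -powRrM (_ : 2 / s * (s / 2) = 1) ?powRr1//.
    by field; lra.
  by apply: ge0_ler_powR; rewrite ?nnegrE ?powR_ge0; lra.
have w8s : (w / 8) `^ (- s) <= 8 * w `^ (- s).
  rewrite powRM; try lra.
  rewrite mulrC ler_wpM2r ?powR_ge0// -powR_inv1// -powRrM mulN1r opprK.
  rewrite -[leRHS]powRr1//; apply: ler_powR; lra.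
have ws : w `^ (- s) * 48 <= w `^ (- (s / 2)).
  apply: (@le_trans _ _ (w `^ (- s) * w `^ (s / 2))).
    by rewrite ler_wpM2l ?powR_ge0.
  rewrite -powRD; last by rewrite (gt_eqF w0) implybT.
  by rewrite (_ : - s + s / 2 = - (s / 2))//; field.
have -> : - (s / (2 * p)) = - (s / 2) / p by field; lra.
rewrite powRrM; apply: ge0_ler_powR; rewrite ?nnegrE ?invr_ge0 ?powR_ge0//.
- lra.
- lra.
Qed.

End DigitCount.

(** * The two widths *)

Lemma trig_width_torus_le (R : realType) (p : R) (L r m n N : nat) :
  0 < p < 1 -> (0 < L)%N -> r.+1 = (16 * L ^ 3)%N ->
  (2 * N < (2 * r + 1) ^ m)%N -> ((2 * r) ^ m <= n)%N ->
  (trig_width char_torus (Lp_torus p) n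
     [set char_torus k | k in [set k : int | (- N%:Z <= k <= N%:Z)%R]]
   <= ((L%:R `^ (- p) + L%:R `^ (p - 1) * 5) `^ p^-1)%:E)%E.
Proof.
move=> p01 L0 rE Nm rn; have /andP[p0 _] := p01.
have -> : [set char_torus k | k in [set k : int | (- N%:Z <= k <= N%:Z)%R]] =
    [set @char_torus R (1 *~ k) | k in [set k : int | (- N%:Z <= k <= N%:Z)%R]].
  by apply: eq_imagel => k _; rewrite intz.
apply: trig_width_zero_free L0 rE Nm rn => //.
- exact: char_torusD.
- exact: normc_char_torus.
- by move=> h G c d; exact: Lp_torus_le.
Qed.

Lemma trig_width_cyclic_le (R : realType) (p : R) (L r m n N : nat) :
  (1 < N)%N -> 0 < p < 1 -> (0 < L)%N -> r.+1 = (16 * L ^ 3)%N ->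
  (2 * N < (2 * r + 1) ^ m)%N -> ((2 * r) ^ m <= n)%N ->
  (trig_width (@char_cyclic R N) (@Lp_cyclic R N p) n
     [set @char_cyclic R N k | k in [set: 'Z_N]]
   <= ((L%:R `^ (- p) + L%:R `^ (p - 1) * 5) `^ p^-1)%:E)%E.
Proof.
move=> N1 p01 L0 rE Nm rn; have /andP[p0 _] := p01.
have -> : [set @char_cyclic R N k | k in [set: 'Z_N]] =
    [set @char_cyclic R N (1 *~ k) | k in
      [set k : int | (- N%:Z <= k <= N%:Z)%R]].
  apply/seteqP; split => _ [k kN <-]; last by exists (1 *~ k).
  exists (k : nat)%:Z; last by rewrite -pmulrn natr_Zp.
  by have := ltn_ord k; rewrite /= [X in (_ < X)%N]Zp_cast//; lia.
apply: trig_width_zero_free L0 rE Nm rn => //.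
- exact: char_cyclicD.
- exact: normc_char_cyclic.
- by move=> h G c d _; exact: Lp_cyclic_le.
Qed.

Theorem theorem1p5 (R : realType) :
  exists c2 : R, 0 < c2 /\
  forall p : R, 0 < p < 1 ->
  exists c1 : R, 0 < c1 /\
  \forall N \near \oo, forall n : nat,
    N%:R * expR (- (ln N%:R `^ c2)) <= n%:R :> R ->
    (trig_width char_torus (Lp_torus p) n
       [set char_torus k | k in [set k : int | (- N%:Z <= k <= N%:Z)%R]]
       <= (ln N%:R `^ (- c1))%:E)%E /\
    (trig_width (@char_cyclic R N) (@Lp_cyclic R N p) n
       [set @char_cyclic R N k | k in [set: 'Z_N]]
       <= (ln N%:R `^ (- c1))%:E)%E.
Proof.
exists (1 / 4); split; first lra.
move=> p p01; have /andP[p0 p1] := p01.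
pose s := Num.min p (1 - p).
have s0 : 0 < s by rewrite lt_min p0; lra.
have sp : s <= p by rewrite ge_min lexx.
have sp1 : s <= 1 - p by rewrite ge_min lexx orbT.
exists (s / (24 * p)); split; first by rewrite divr_gt0//; lra.
(* A is the threshold for w = (ln N)^(1/12) beyond which the estimates hold. *)
pose A := Num.max 8 (48 `^ (2 / s)) : R.
have A0 : 0 <= A by rewrite le_max; apply/orP; left; lra.
near=> N => n Nn.
have lnN : A ^+ 12 <= ln N%:R.
  rewrite -ler_expR lnK; first by near: N; exact: nbhs_infty_ger.
  by rewrite posrE ltr0n; near: N; exact: nbhs_infty_gt.
have lnN0 : 0 <= ln N%:R :> R by apply: le_trans lnN; exact: exprn_ge0.
pose w := ln N%:R `^ (12^-1 : R).
have wX a : w `^ a = ln N%:R `^ (a / 12) by rewrite -powRrM mulrC.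
have w12 : ln N%:R = w ^+ 12.
  by rewrite -powR_mulrn ?powR_ge0// wX mulfV ?powRr1.
have wA : A <= w.
  by rewrite -(@ler_pXn2r _ 12%N) ?nnegrE ?powR_ge0// -w12.
have w8 : 8 <= w by apply: le_trans wA; rewrite le_max lexx.
have w48 : 48 `^ (2 / s) <= w by apply: le_trans wA; rewrite le_max lexx orbT.
have [L [r [m [L0 rE wL Nm rm]]]] := zero_free_parameters w8 w12.
have rn : ((2 * r) ^ m <= n)%N.
  rewrite -(ler_nat R); apply: le_trans rm _; apply: le_trans Nn.
  rewrite (_ : w ^+ 3 = ln N%:R `^ (1 / 4))//.
  by rewrite -powR_mulrn ?powR_ge0// wX; congr (_ `^ _); field.
have err : (L%:R `^ (- p) + L%:R `^ (p - 1) * 5) `^ p^-1 <=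
    ln N%:R `^ (- (s / (24 * p))).
  rewrite (_ : - (s / (24 * p)) = - (s / (2 * p)) / 12); last by field; lra.
  by rewrite -wX; exact: error_powR_le.
split; rewrite -lee_fin in err; apply: le_trans err.
  exact: trig_width_torus_le Nm rn.
apply: trig_width_cyclic_le Nm rn => //.
by near: N; exact: nbhs_infty_gt.
Unshelve. all: by end_near. Qed.
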